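(* Let $d\in\mathbb{N}$ and let $\boldsymbol X=(X_0,\dots,X_d)$ be a standard max-stable random vector with $D$-norm $\|\cdot\|_{D_{0,\dots,d}}$ on $\mathbb{R}^{d+1}$ generated by $\boldsymbol Z=(Z_0,\dots,Z_d)$. Let $g_0,\dots,g_d\in\bar C^+[0,1]$ be deterministic functions such that $$\|(g_0(t),\dots,g_d(t))\|_{D_{0,\dots,d}}=1,\qquad t\in[0,1].$$ Put $$\eta_t:=\max_{i=0,\dots,d}\frac{X_i}{g_i(t)},\qquad t\in[0,1].$$ Then the stochastic process $\boldsymbol\eta=(\eta_t)_{t\in[0,1]}$ is a standard max-stable process with generator process $\hat{\boldsymbol Z}=(\hat Z_t)_{t\in[0,1]}$ given by $$\hat Z_t=\max_{i=0,\dots,d}\bigl(g_i(t)Z_i\bigr),\qquad t\in[0,1].$$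
   Context: Standard max-stable random vector: $\boldsymbol X=(X_0,\dots,X_d)$ is standard max-stable if it is max-stable with margins $P(X_i\le x)=e^{x}$, $x\le 0$. Equivalently, there is a random vector $\boldsymbol Z=(Z_0,\dots,Z_d)$ with $0\le Z_i\le c$ a.s. for some constant $c\ge1$ and $E(Z_i)=1$ for all $i$ (a generator), such that $P(\boldsymbol X\le\boldsymbol x)=\exp(-\|\boldsymbol x\|_{D_{0,\dots,d}})$ for all $\boldsymbol x\le\boldsymbol 0$, where $\|\boldsymbol x\|_{D_{0,\dots,d}}:=E(\max_{0\le i\le d}|x_i|Z_i)$ is a norm on $\mathbb{R}^{d+1}$, called the $D$-norm generated by $\boldsymbol Z$. Inequalities between vectors or functions are componentwise/pointwise. Function spaces: $\bar C^+[0,1]=\{g\in C[0,1]:g\ge0\}$, $\bar C^-[0,1]=\{h\in C[0,1]:h\le0\}$. $E[0,1]$ is the set of bounded functions $f:[0,1]\to\mathbb{R}$ with only finitely many discontinuities, and $\bar E^-[0,1]=\{f\in E[0,1]:f\le 0\}$. Standard max-stable process (SMSP): a max-stable process $\boldsymbol\eta=(\eta_t)_{t\in[0,1]}$ with sample paths in $\bar C^-[0,1]$ and univariate margins $P(\eta_t\le x)=e^x$, $x\le0$. Equivalently, there is a process $\boldsymbol Z=(Z_t)_{t\in[0,1]}$ with sample paths in $\bar C^+[0,1]$, $Z_t\le c$ a.s. for all $t$ for some constant $c\ge1$, and $E(Z_t)=1$ for all $t$ (a generator process), such that $P(\boldsymbol\eta\le f)=\exp(-\|f\|_D)$ for all $f\in\bar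 E^-[0,1]$, where $\|f\|_D:=E(\sup_{t\in[0,1]}|f(t)|Z_t)$. ''$\boldsymbol\eta$ has generator process $\boldsymbol Z$'' means this identity holds with $\boldsymbol Z$. Convention: $X_i<0$ a.s., and $x/0:=-\infty$ for $x<0$. *)

(* Defs.v *)
From HB Require Import structures.
From mathcomp Require Import all_boot all_order all_algebra.
From mathcomp Require Import all_classical all_reals all_analysis.
Import Order.TTheory GRing.Theory Num.Theory.
Import numFieldNormedType.Exports.

Set Implicit Arguments.
Unset Strict Implicit.
Unset Printing Implicit Defensive.

Local Open Scope classical_set_scope.
Local Open Scope ring_scope.

(* A stochastic process with index set [D : set I] is a family
   [xi : I -> T -> R] of which only the members [xi t], [D t], matter. Random
   vectors have [I = 'I_d.+1] and [D = setT]; processes on the unit interval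
   have [I = R] and [D = `[0, 1]]. *)

(* The maximum of a nonempty finite family; starting the iteration from one of
   its members makes it exact whatever the signs. *)
Definition fmax (R : realType) (n : nat) (F : 'I_n.+1 -> R) : R :=
  \big[Num.max/F ord0]_(i < n.+1) F i.

Definition is_process (I : Type) (D : set I) (R : realType)
    (d : measure_display) (T : measurableType d) (xi : I -> T -> R) : Prop :=
  forall t, D t -> measurable_fun setT (xi t).

Definition path_of (I T : Type) (R : realType) (xi : I -> T -> R)
  : T -> I -> R := fun w t => xi t w.

(* The product sigma-algebra, generated by the evaluations at points of [D]. On
   C[0,1] it induces the Borel sigma-algebra of the uniform norm. *)
Definition path_event (I : Type) (D : set I) (R : realType)
  : set_system (I -> R) :=
  <<s [set A | exists t (B : set R),
         [/\ D t, measurable B & A = [set x | B (x t)]]] >>.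

Definition eq_law (I : Type) (D : set I) (R : realType)
    (d : measure_display) (T : measurableType d) (P : probability T R)
    (xi : I -> T -> R)
    (d' : measure_display) (T' : measurableType d') (P' : probability T' R)
    (xi' : I -> T' -> R) : Prop :=
  forall A, path_event D A ->
    P (path_of xi @^-1` A) = P' (path_of xi' @^-1` A).

(* The product rule for subfamilies is the case where some [A k] are [setT]. *)
Definition independent_processes (I : Type) (D : set I) (R : realType)
    (d : measure_display) (T : measurableType d) (P : probability T R)
    (n : nat) (xi : 'I_n -> I -> T -> R) : Prop :=
  forall A : 'I_n -> set (I -> R), (forall k, path_event D (A k)) ->
    P (\bigcap_(k in [set: 'I_n]) (path_of (xi k) @^-1` A k)) =
    (\prod_(k < n) P (path_of (xi k) @^-1` A k))%E.

Definition iid_copies (I : Type) (D : set I) (R : realType)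
    (d : measure_display) (T : measurableType d) (P : probability T R)
    (xi : I -> T -> R)
    (d' : measure_display) (T' : measurableType d') (P' : probability T' R)
    (n : nat) (xi' : 'I_n -> I -> T' -> R) : Prop :=
  [/\ forall k, is_process D (xi' k),
      forall k, eq_law D P' (xi' k) P xi
    & independent_processes D P' xi'].

(* For every n >= 1 there are norming functions a > 0 and b in the class [C]
   such that max_(k < n) (xi_k - b) / a has the law of xi, whenever the xi_k are
   independent copies of xi (on any probability space). *)
Definition max_stable (I : Type) (D : set I) (R : realType)
    (C : set (I -> R))
    (d : measure_display) (T : measurableType d) (P : probability T R)
    (xi : I -> T -> R) : Prop :=
  forall n : nat, exists a b : I -> R,
    [/\ C a, C b, forall t, D t -> 0 < a t
      & forall (d' : measure_display) (T' : measurableType d')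
          (P' : probability T' R) (xi' : 'I_n.+1 -> I -> T' -> R),
          iid_copies D P xi P' xi' ->
          eq_law D P' (fun t w => fmax (fun k => (xi' k t w - b t) / a t))
                 P xi].

Definition neg_exp_margins (I : Type) (D : set I) (R : realType)
    (d : measure_display) (T : measurableType d) (P : probability T R)
    (xi : I -> T -> R) : Prop :=
  forall (t : I) (x : R), D t -> x <= 0 -> P [set w | xi t w <= x] = (expR x)%:E.

(* Random vectors *)

Definition standard_max_stable_vector (R : realType)
    (dT : measure_display) (T : measurableType dT) (P : probability T R)
    (d : nat) (X : 'I_d.+1 -> T -> R) : Prop :=
  [/\ is_process setT X, max_stable setT setT P X & neg_exp_margins setT P X].

Definition is_generator (R : realType)
    (dT : measure_display) (T : measurableType dT) (Q : probability T R)
    (d : nat) (Z : 'I_d.+1 -> T -> R) : Prop :=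
  [/\ is_process setT Z,
      exists2 c : R, 1 <= c &
        forall i, {ae Q, forall w, 0 <= Z i w <= c}
    & forall i, ('E_Q[Z i] = 1)%E].

Definition Dnorm (R : realType)
    (dT : measure_display) (T : measurableType dT) (Q : probability T R)
    (d : nat) (Z : 'I_d.+1 -> T -> R) (x : 'I_d.+1 -> R) : \bar R :=
  ('E_Q[fun w => fmax (fun i => (`|x i| * Z i w)%R)])%E.

Definition has_generator (R : realType)
    (dT : measure_display) (T : measurableType dT) (P : probability T R)
    (d : nat) (X : 'I_d.+1 -> T -> R)
    (dT' : measure_display) (T' : measurableType dT') (Q : probability T' R)
    (Z : 'I_d.+1 -> T' -> R) : Prop :=
  is_generator Q Z /\
  forall x : 'I_d.+1 -> R, (forall i, x i <= 0) ->
    P [set w | forall i, X i w <= x i] = expeR (- Dnorm Q Z x)%E.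

(* Functions and processes on [0, 1] *)

Definition unit_itv (R : realType) : set R := `[0, 1].
Arguments unit_itv {R}.

Definition C01 (R : realType) : set (R -> R) :=
  [set f | {within unit_itv, continuous f}].

Definition Cplus (R : realType) : set (R -> R) :=
  [set f | C01 f /\ forall t, unit_itv t -> 0 <= f t].

Definition Cminus (R : realType) : set (R -> R) :=
  [set f | C01 f /\ forall t, unit_itv t -> f t <= 0].

Definition E01 (R : realType) : set (R -> R) :=
  [set f | (exists M : R, forall t, unit_itv t -> `|f t| <= M) /\
    finite_set [set t | unit_itv t /\
                        ~ (f x @[x --> within unit_itv (nbhs t)] --> f t)]].

Definition Eminus (R : realType) : set (R -> R) :=
  [set f | E01 f /\ forall t, unit_itv t -> f t <= 0].

Definition smsp (R : realType)
    (dT : measure_display) (T : measurableType dT) (P : probability T R)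
    (eta : R -> T -> R) : Prop :=
  [/\ is_process unit_itv eta,
      max_stable unit_itv (@C01 R) P eta,
      {ae P, forall w, Cminus (path_of eta w)}
    & neg_exp_margins unit_itv P eta].

Definition is_generator_process (R : realType)
    (dT : measure_display) (T : measurableType dT) (Q : probability T R)
    (Z : R -> T -> R) : Prop :=
  [/\ is_process unit_itv Z,
      {ae Q, forall w, Cplus (path_of Z w)},
      exists2 c : R, 1 <= c &
        forall t, unit_itv t -> {ae Q, forall w, Z t w <= c}
    & forall t, unit_itv t -> ('E_Q[Z t] = 1)%E].

Definition Dnorm_process (R : realType)
    (dT : measure_display) (T : measurableType dT) (Q : probability T R)
    (Z : R -> T -> R) (f : R -> R) : \bar R :=
  (\int[Q]_w ereal_sup [set (`|f t| * Z t w)%:E | t in unit_itv])%E.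

(* The set {eta <= f} is an uncountable intersection, and paths are only
   required to be continuous almost surely: its measurability is made explicit
   because [P] has no meaning outside the sigma-algebra. *)
Definition has_generator_process (R : realType)
    (dT : measure_display) (T : measurableType dT) (P : probability T R)
    (eta : R -> T -> R)
    (dT' : measure_display) (T' : measurableType dT') (Q : probability T' R)
    (Z : R -> T' -> R) : Prop :=
  is_generator_process Q Z /\
  forall f, Eminus f ->
    let eta_le_f := [set w | forall t, unit_itv t -> eta t w <= f t] in
    measurable eta_le_f /\ P eta_le_f = expeR (- Dnorm_process Q Z f)%E.

(* Division with the convention x / 0 = -oo, which is meant for x < 0. *)
Definition quot (R : realType) (x y : R) : \bar R :=
  if y == 0 then -oo%E else (x / y)%:E.

(* [fine] only converts the type when some [g i t] is nonzero: the maximum is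
   then a real number. *)
Definition max_linear (R : realType) (T : Type) (d : nat)
    (X : 'I_d.+1 -> T -> R) (g : 'I_d.+1 -> R -> R) : R -> T -> R :=
  fun t w => fine (\big[maxe/-oo%E]_(i < d.+1) quot (X i w) (g i t)).

Definition max_generator (R : realType) (T : Type) (d : nat)
    (g : 'I_d.+1 -> R -> R) (Z : 'I_d.+1 -> T -> R) : R -> T -> R :=
  fun t w => fmax (fun i => g i t * Z i w).

(* Main.v *)
Require Import Defs.
From HB Require Import structures.
From mathcomp Require Import all_boot all_order all_algebra.
From mathcomp Require Import all_classical all_reals all_analysis.
From mathcomp Require Import measurable_realfun.
Import Order.TTheory GRing.Theory Num.Theory.
Import numFieldNormedType.Exports.
Local Open Scope classical_set_scope.
Local Open Scope ring_scope.

(** Whatever the signs, [eta_t <= y] iff [X_i <= g_i(t) y] for all [i] with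
    [0 < g_i(t)]. Hence, for any family [J] of constraints [eta_t <= y], almost
    surely all of them hold iff [X_i <= m_i] for all [i], where
    [m_i = inf ({0} U {g_i(t) y | (t, y) in J})]; adjoining [0] costs nothing
    because [X_i < 0] almost surely. So the probability of the constraints is
    [exp (- ||m||_D)]. Singletons [J] give the margins, the graph of [f] gives
    the generator formula, and finite [J] give the finite-dimensional laws;
    since [m] scales with [J] and [||.||_D] is homogeneous, these satisfy
    [F(y / n) ^ n = F(y)], which is max-stability with constant norming
    functions. Paths are continuous because
    [eta_t = - 1 / max_i (g_i(t) / - X_i)]. *)

Set Implicit Arguments.
Unset Strict Implicit.
Unset Printing Implicit Defensive.

(** * Maxima of nonempty finite families *)

Section fmax.
Variables (R : realType) (n : nat).
Implicit Types F : 'I_n.+1 -> R.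

Lemma fmax_leP F y : fmax F <= y <-> forall i, F i <= y.
Proof.
split=> [/bigmax_leP[_ Fy] i|Fy]; first exact: Fy.
by apply/bigmax_leP; split.
Qed.

Lemma le_fmax F i : F i <= fmax F.
Proof. exact: le_bigmax. Qed.

Lemma fmax_ge0 F : (forall i, 0 <= F i) -> 0 <= fmax F.
Proof. by move=> F0; exact: le_trans (le_fmax F ord0). Qed.

Lemma fmaxZl F a : 0 <= a -> fmax (fun i => a * F i) = a * fmax F.
Proof.
move=> a0; apply/eqP; rewrite eq_le; apply/andP; split.
  by apply/fmax_leP => i; rewrite ler_wpM2l// le_fmax.
(* The property [a * x <= fmax (fun i => a * F i)] of [x] holds for every member of [F], including
   the start value, and passes to binary maxima. *)
rewrite /fmax; elim/big_ind : _ => [|x y xm ym|i _].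
- exact: (le_fmax (fun i => a * F i)).
- by rewrite maxr_pMr// ge_max xm ym.
- exact: (le_fmax (fun i => a * F i)).
Qed.

Lemma measurable_fmax d (T : measurableType d) (F : 'I_n.+1 -> T -> R) :
  (forall i, measurable_fun setT (F i)) ->
  measurable_fun setT (fun w => fmax (F^~ w)).
Proof.
move=> mF; rewrite /fmax; elim: (index_enum _) => [|i s ih].
  by under eq_fun do rewrite big_nil; exact: mF.
under eq_fun do rewrite big_cons.
exact: (measurable_maxr (mF i) ih).
Qed.

Lemma continuous_fmax (U : topologicalType) (F : 'I_n.+1 -> U -> R) :
  (forall i, continuous (F i)) -> continuous (fun x => fmax (F^~ x)).
Proof.
move=> cF x; rewrite /fmax; elim: (index_enum _) => [|i s ih].
  by under eq_fun do rewrite big_nil; exact: cF.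
under eq_fun do rewrite big_cons.
exact: (continuous_max (cF i x) ih).
Qed.

End fmax.

(** * Sublevel sets of the max-linear process, free of division *)

Section max_linear.
Variables (R : realType) (T : Type) (d : nat).
Variables (X : 'I_d.+1 -> T -> R) (g : 'I_d.+1 -> R -> R).

(** An index with [g i t = 0] contributes -oo and imposes no constraint; for the others one
    multiplies by [g i t]. A single nonzero [g i t] makes the maximum a real number, so [fine] loses
    nothing. The equivalence holds at every [w], which later gives exact descriptions of events. *)
Lemma max_linear_leP t w y :
  (forall i, 0 <= g i t) -> (exists i, g i t != 0) ->
  max_linear X g t w <= y <-> forall i, 0 < g i t -> X i w <= g i t * y.
Proof.
move=> g0 [j gj]; rewrite /max_linear.
set M := \big[_/_]_(i < d.+1) _.
have Mfin : M \is a fin_num.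
  rewrite fin_numE; apply/andP; split.
    have : (quot (X j w) (g j t) <= M)%E by exact: le_bigmax.
    rewrite /quot (negbTE gj) => XM.
    by rewrite gt_eqF// (lt_le_trans _ XM)// ltNyr.
  rewrite lt_eqF//; apply/bigmax_ltP; split=> // i _.
  by rewrite /quot; case: ifP => // _; rewrite ltry.
rewrite -lee_fin fineK//; split=> [/bigmax_leP[_ My] i gi|Xy].
  have := My i isT; rewrite /quot gt_eqF//= lee_fin.
  by rewrite ler_pdivrMr// mulrC.
apply/bigmax_leP; split=> [|i _]; rewrite ?leNye// /quot; case: ifPn => [_|gi].
  by rewrite leNye.
have {}gi : 0 < g i t by rewrite lt0r gi g0.
by rewrite lee_fin ler_pdivrMr// mulrC; exact: Xy.
Qed.

End max_linear.

(** * Comparison of measures and integrability up to null sets *)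

Section almost_everywhere_facts.
Variables (R : realType) (d : measure_display) (T : measurableType d).
Variable P : probability T R.

(** The exceptional points lie in a measurable null set [N], so [A] is contained in the union of [B]
    and [N], which has the measure of [B]. *)
Lemma ae_le_measure (A B : set T) : measurable A -> measurable B ->
  {ae P, forall w, A w -> B w} -> (P A <= P B)%E.
Proof.
move=> mA mB [N [mN PN0 AB]]; rewrite -(measureU0 mB mN PN0).
apply: le_measure; rewrite ?inE//; first exact: measurableU.
move=> w Aw; have [Bw|Bw] := pselect (B w); first by left.
by right; apply: AB => /(_ Aw).
Qed.

Lemma ae_eq_measure (A B : set T) : measurable A -> measurable B ->
  {ae P, forall w, A w <-> B w} -> P A = P B.
Proof.
move=> mA mB AB; apply/eqP; rewrite eq_le; apply/andP.
by split; apply: ae_le_measure => //; apply: (filterS _ AB) => w [].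
Qed.

Lemma ae_bounded_integrable (f : T -> R) (C : R) : measurable_fun setT f ->
  {ae P, forall w, `|f w| <= C} -> P.-integrable setT (EFin \o f).
Proof.
move=> mf fC; apply/integrableP; split; first exact/measurable_EFinP.
have /le_lt_trans : (\int[P]_w `|(f w)%:E| <= \int[P]_w (cst `|C|%:E) w)%E.
  apply: ae_ge0_le_integral => //.
  - by apply/measurable_EFinP; exact: measurableT_comp.
  - by move=> w _; rewrite lee_fin.
  - apply: (filterS _ fC) => w {}fC _.
    by rewrite lee_fin (le_trans fC)// ler_norm.
apply.
by rewrite integral_cst//= probability_setT mule1 ltry.
Qed.

End almost_everywhere_facts.

(** * Finiteness and homogeneity of the D-norm *)

Section generator.
Variables (R : realType) (dT : measure_display) (T : measurableType dT).
Variables (Q : probability T R) (d : nat) (Z : 'I_d.+1 -> T -> R).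
Hypothesis Z_gen : is_generator Q Z.

Lemma generator_measurable i : measurable_fun setT (Z i).
Proof. by case: Z_gen => mZ _ _; exact: mZ. Qed.

(** The null set in the definition may depend on [i]; finitely many of them are merged into one. *)
Lemma generator_bounded :
  exists2 c : R, 1 <= c & {ae Q, forall w, forall i, 0 <= Z i w <= c}.
Proof.
by case: Z_gen => _ [c c1 Zc] _; exists c => //; exact: filter_forall.
Qed.

Lemma measurable_weighted_fmax (a : 'I_d.+1 -> R) :
  measurable_fun setT (fun w => fmax (fun i => a i * Z i w)).
Proof.
apply: measurable_fmax => i; apply: measurable_funM => //.
exact: generator_measurable.
Qed.

Lemma DnormE (x : 'I_d.+1 -> R) :
  Dnorm Q Z x = (\int[Q]_w (fmax (fun i => `|x i| * Z i w))%:E)%E.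
Proof. by rewrite /Dnorm unlock. Qed.

Lemma integrable_Dnorm (x : 'I_d.+1 -> R) :
  Q.-integrable setT (EFin \o (fun w => fmax (fun i => `|x i| * Z i w))).
Proof.
have [c _ Zc] := generator_bounded.
apply: (@ae_bounded_integrable _ _ _ _ _ (fmax (fun i => `|x i| * c))).
  exact: measurable_weighted_fmax.
apply: (filterS _ Zc) => w {}Zc; rewrite ger0_norm.
  apply/fmax_leP => i; apply: (le_trans _ (le_fmax _ i)).
  by rewrite ler_wpM2l//; case/andP: (Zc i).
by apply: fmax_ge0 => i; rewrite mulr_ge0//; case/andP: (Zc i).
Qed.

Lemma Dnorm_fin_num (x : 'I_d.+1 -> R) : Dnorm Q Z x \is a fin_num.
Proof.
by rewrite DnormE; apply: integrable_fin_num => //; exact: integrable_Dnorm.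
Qed.

Lemma DnormZ (a : R) (x : 'I_d.+1 -> R) : 0 <= a ->
  Dnorm Q Z (fun i => a * x i) = (a%:E * Dnorm Q Z x)%E.
Proof.
move=> a0; rewrite !DnormE -integralZl//; last exact: integrable_Dnorm.
apply: eq_integral => w _; rewrite -EFinM -fmaxZl//; congr (fmax _)%:E.
by apply/funext => i; rewrite normrM (ger0_norm a0) mulrA.
Qed.

Lemma DnormN (x : 'I_d.+1 -> R) : Dnorm Q Z (fun i => - x i) = Dnorm Q Z x.
Proof. by rewrite /Dnorm; under eq_fun do under eq_fun do rewrite normrN. Qed.

End generator.

(** * Infima of sets with 0 adjoined *)

Lemma finite_has_lbound (R : realType) (A : set R) :
  finite_set A -> has_lbound A.
Proof.
move=> /finite_seqP[s ->]; exists (\big[Num.min/0]_(x <- s) x) => x xs.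
exact: (bigmin_inf_seq 0 x).
Qed.

(** Adjoining 0 makes the set nonempty, so that with a lower bound the infimum is a true greatest
    lower bound, even for empty [A]. *)
Lemma le_inf0P (R : realType) (A : set R) (x : R) : has_lbound A ->
  x <= inf (0 |` A) <-> x <= 0 /\ forall a, A a -> x <= a.
Proof.
move=> [m mA].
have lb0A : has_lbound (0 |` A).
  exists (Num.min 0 m) => y [->|/mA my]; first by rewrite ge_min lexx.
  by rewrite ge_min my orbT.
split=> [xA|[x0 xA]].
  by split=> [|a Aa]; apply: le_trans xA _; apply: ge_inf => //; [left|right].
by apply: lb_le_inf => [|y [->|/xA]//]; exists 0; left.
Qed.

(** Scaling fixes the adjoined 0 and preserves order. This makes the levels below homogeneous in
    their constraints. *)
Lemma inf0M (R : realType) (A : set R) (a : R) : 0 < a -> has_lbound A ->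
  inf (0 |` [set a * x | x in A]) = a * inf (0 |` A).
Proof.
move=> a0 lbA.
have lbaA : has_lbound [set a * x | x in A].
  by case: lbA => m mA; exists (a * m) => _ [x /mA mx <-]; rewrite ler_pM2l.
apply/eqP; rewrite eq_le; apply/andP; split.
  rewrite -ler_pdivrMl//; apply/le_inf0P => //.
  have /le_inf0P[//|h0 h] := lexx (inf (0 |` [set a * x | x in A])).
  split=> [|x Ax]; first by rewrite ler_pdivrMl// mulr0.
  by rewrite ler_pdivrMl//; apply: h; exists x.
have /le_inf0P[//|h0 h] := lexx (inf (0 |` A)).
apply/le_inf0P => //; split=> [|_ [x Ax <-]].
  by rewrite pmulr_rle0.
by rewrite ler_pM2l//; exact: h.
Qed.

(** * Laws of processes are determined by orthant probabilities *)

Section path_law.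
Variables (I : Type) (D : set I) (R : realType).

(** Constraints are kept as a set of pairs (time, bound), so that a union of constraint sets gives
    the intersection of the orthants even if times repeat. *)
Definition orthant (J : set (I * R)) : set (I -> R) :=
  [set x | forall p, J p -> x p.1 <= p.2].

Definition finite_orthants : set_system (I -> R) :=
  [set A | exists J, [/\ finite_set J, forall p, J p -> D p.1 & A = orthant J]].

Let orthantE J : orthant J = \bigcap_(p in J) [set x | x p.1 <= p.2].
Proof. by apply/seteqP; split. Qed.

Lemma path_event_orthant J : finite_set J -> (forall p, J p -> D p.1) ->
  path_event D (orthant J).
Proof.
move=> fJ DJ; rewrite orthantE /path_event; set G := [set A | _].
apply: (@fin_bigcap_measurable _ (g_sigma_algebraType G)) => // p Jp.
apply: sub_sigma_algebra; exists p.1, [set y | y <= p.2]; split=> //.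
  exact: DJ.
by apply: closed_measurable; exact: closed_le.
Qed.

(** The rays []y, +oo[] generate the Borel sets, and the preimage of such a ray under evaluation at
    [t] is the complement of an orthant with one constraint. *)
Lemma sub_path_event_orthants : @path_event I D R `<=` <<s finite_orthants>>.
Proof.
apply: smallest_sub; first exact: smallest_sigma_algebra.
move=> _ [t [B [Dt mB ->]]].
have mev : measurable_fun setT
    ((fun x => x t) : g_sigma_algebraType finite_orthants -> R).
  apply: (measurability _ (RGenOInfty.measurableE R)).
  move=> _ [_ [y ->] <-]; rewrite setTI.
  rewrite (_ : _ @^-1` _ = ~` orthant [set (t, y)]).
    apply: measurableC; apply: sub_sigma_algebra.
    by exists [set (t, y)]; split=> // _ ->.
  apply/seteqP; split=> x; rewrite /orthant/= in_itv/= andbT.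
    by move=> yx /(_ (t, y) erefl)/=; rewrite leNgt yx.
  by move=> h; rewrite ltNge; apply/negP => xy; apply: h => _ ->.
by rewrite -[X in <<s _ >> X]setTI; exact: mev.
Qed.

Lemma measurable_path_of d (T : measurableType d) (xi : I -> T -> R) :
  is_process D xi ->
  measurable_fun setT
    (path_of xi : T -> g_sigma_algebraType finite_orthants).
Proof.
move=> mxi; apply: (@measurability _ _ _
  (g_sigma_algebraType finite_orthants) _ _ finite_orthants) => //.
move=> _ [_ [J [fJ DJ ->]] <-]; rewrite setTI orthantE preimage_bigcap.
apply: fin_bigcap_measurable => // p Jp; rewrite -[X in measurable X]setTI.
apply: (mxi p.1 (DJ _ Jp) _ [set y | y <= p.2]) => //.
by apply: closed_measurable; exact: closed_le.
Qed.

(** Dynkin's theorem: finite orthants are stable under intersection and generate all path events,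
    while the sets on which the two laws agree are stable under complements and countable disjoint
    unions. *)
Lemma eq_law_orthant
    (d : measure_display) (T : measurableType d) (P : probability T R)
    (d' : measure_display) (T' : measurableType d') (P' : probability T' R)
    (xi : I -> T -> R) (xi' : I -> T' -> R) :
  is_process D xi -> is_process D xi' ->
  (forall J, finite_set J -> (forall p, J p -> D p.1) ->
    P (path_of xi @^-1` orthant J) = P' (path_of xi' @^-1` orthant J)) ->
  eq_law D P xi P' xi'.
Proof.
move=> mxi mxi' eqJ A /sub_path_event_orthants sA.
have trivIset_pre (U V : Type) (h : U -> V) (F : (set V)^nat) :
    trivIset setT F -> trivIset setT (fun k => h @^-1` F k).
  move=> /trivIsetP tF; apply/trivIsetP => i j _ _ ij.
  by rewrite -preimage_setI tF// preimage_set0.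
pose GT := g_sigma_algebraType finite_orthants.
have mpre S : @measurable _ GT S -> measurable (path_of xi @^-1` S).
  by move=> mS; rewrite -[X in measurable X]setTI; exact: measurable_path_of.
have mpre' S : @measurable _ GT S -> measurable (path_of xi' @^-1` S).
  by move=> mS; rewrite -[X in measurable X]setTI; exact: measurable_path_of.
apply: (@dynkin_induction _ GT finite_orthants (fun S =>
  P (path_of xi @^-1` S) = P' (path_of xi' @^-1` S)) erefl) => //.
- move=> _ _ [J [fJ DJ ->]] [K [fK DK ->]]; exists (J `|` K); split.
  + by rewrite finite_setU.
  + by move=> p [/DJ|/DK].
  + apply/seteqP; split=> x; first by move=> [xJ xK] p [/xJ|/xK].
    by move=> xJK; split=> p ?; apply: xJK; [left|right].
- by rewrite !preimage_setT !probability_setT.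
- by move=> _ [J [fJ DJ ->]]; exact: eqJ.
- move=> S mS PS.
  have := probability_setC P (mpre S mS).
  have := probability_setC P' (mpre' S mS).
  by rewrite PS => <- ->.
- move=> F mF tF PF; rewrite !preimage_bigcup.
  rewrite measure_bigcup;
    [|by move=> k _; apply: mpre; exact: mF|exact: trivIset_pre].
  rewrite measure_bigcup;
    [|by move=> k _; apply: mpre'; exact: mF|exact: trivIset_pre].
  by apply: eq_eseriesr => k _; exact: PF.
Qed.
End path_law.

(** * The max-linear process: standing hypotheses and bounds on the coefficients *)

Section max_linear_process.
Variables (R : realType) (dT : measure_display) (T : measurableType dT).
Variables (P : probability T R) (dT' : measure_display).
Variables (T' : measurableType dT') (Q : probability T' R).
Variables (d : nat) (X : 'I_d.+1 -> T -> R) (Z : 'I_d.+1 -> T' -> R).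
Variable g : 'I_d.+1 -> R -> R.
Hypothesis X_meas : is_process setT X.
Hypothesis X_lt0 : forall i, {ae P, forall w, X i w < 0}.
Hypothesis X_gen : has_generator P X Q Z.
Hypothesis g_Cplus : forall i, Cplus (g i).
Hypothesis g_norm1 : forall t, unit_itv t -> Dnorm Q Z (fun i => g i t) = 1%E.

Local Notation eta := (max_linear X g).

Let Z_gen : is_generator Q Z. Proof. by case: X_gen. Qed.

Let g_ge0 i t : unit_itv t -> 0 <= g i t.
Proof. by move=> ut; case: (g_Cplus i) => _; exact. Qed.

(** If all [g i t] vanished, the vector would be 0 times itself and have D-norm 0 instead of 1. *)
Let g_neq0 t : unit_itv t -> exists i, g i t != 0.
Proof.
move=> ut; apply: contrapT => /forallNP g0; have := g_norm1 ut.
rewrite (_ : (fun i => g i t) = (fun i => 0 * g i t)); last first.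
  by apply/funext => i; rewrite mul0r; apply/eqP/negPn/negP/g0.
by rewrite DnormZ// mul0e => /eqP; rewrite eq_sym onee_eq0.
Qed.

Let g_bounded : exists2 M, 0 <= M & forall i t, unit_itv t -> g i t <= M.
Proof.
have /choice[c cP] : forall i, exists c, unit_itv c /\
    forall t, unit_itv t -> g i t <= g i c.
  move=> i; case: (g_Cplus i) => cg _.
  have [c uc gc] := EVT_max ler01 cg.
  by exists c; split=> // t ut; exact: gc.
exists (fmax (fun i => g i (c i))).
  by apply: fmax_ge0 => i; apply: g_ge0; case: (cP i).
move=> i t ut; apply: le_trans (le_fmax _ i).
by case: (cP i) => _; exact.
Qed.

Let X_all_lt0 : {ae P, forall w, forall i, X i w < 0}.
Proof. exact: filter_forall. Qed.

(** * Probabilities of families of upper bounds on the process *)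

Definition below (J : set (R * R)) : set T :=
  [set w | forall p, J p -> eta p.1 w <= p.2].

(** The adjoined 0 keeps the level nonpositive, as the formula for the law of [X] demands, also when
    [J] is empty or contains positive bounds. *)
Definition level (J : set (R * R)) (i : 'I_d.+1) : R :=
  inf (0 |` [set g i p.1 * p.2 | p in J]).

Let belowP J w : (forall p, J p -> unit_itv p.1) ->
  below J w <-> forall i p, J p -> 0 < g i p.1 -> X i w <= g i p.1 * p.2.
Proof.
move=> uJ; split=> [Jw i p Jp|XJ p Jp].
  have /max_linear_leP := Jw _ Jp; apply; first by move=> ?; exact/g_ge0/uJ.
  exact/g_neq0/uJ.
apply/max_linear_leP => [i||i]; [exact/g_ge0/uJ|exact/g_neq0/uJ|exact: XJ].
Qed.

(** [J] may be uncountable. Exchanging the quantifiers over [p] and [i] leaves a finite intersection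
    over [i], in which [X i] has to lie in an intersection of closed half-lines, hence in a closed
    set. *)
Lemma measurable_below J :
  (forall p, J p -> unit_itv p.1) -> measurable (below J).
Proof.
move=> uJ.
pose F i := [set x | forall p, J p -> 0 < g i p.1 -> x <= g i p.1 * p.2].
have -> : below J = \bigcap_(i in [set: 'I_d.+1]) (X i @^-1` F i).
  by apply/seteqP; split=> w; rewrite belowP// => h i; [move=> _|]; exact: h.
apply: fin_bigcap_measurable => // i _; rewrite -[_ @^-1` _]setTI.
apply: X_meas => //; apply: closed_measurable.
rewrite (_ : F i = \bigcap_(p in [set p | J p /\ 0 < g i p.1])
  [set x | x <= g i p.1 * p.2]).
  by apply: closed_bigI => p _; exact: closed_le.
by apply/seteqP; split=> x h p; [case=> Jp gp; exact: h|move=> Jp gp; exact: h].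
Qed.

Lemma prob_below J : (forall p, J p -> unit_itv p.1) ->
  (forall i, has_lbound [set g i p.1 * p.2 | p in J]) ->
  P (below J) = expeR (- Dnorm Q Z (level J)).
Proof.
move=> uJ lbJ; case: X_gen => _ <-; last first.
  by move=> i; have /le_inf0P[] := lexx (level J i).
apply: ae_eq_measure; first exact: measurable_below.
  rewrite (_ : [set w | _] =
    \bigcap_(i in [set: 'I_d.+1]) (X i @^-1` [set x | x <= level J i])).
    apply: fin_bigcap_measurable => // i _; rewrite -[_ @^-1` _]setTI.
    by apply: X_meas => //; apply: closed_measurable; exact: closed_le.
  by apply/seteqP; split=> w h i; [move=> _|]; exact: h.
apply: (filterS _ X_all_lt0) => w Xw; rewrite belowP//.
split=> [XJ i|XJ i p Jp _].
  apply/le_inf0P => //; split=> [|_ [p Jp <-]]; first exact: ltW.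
  (* A pair with [g i p.1 = 0] is not constrained by [belowP]; it asks for [X i w <= 0], which holds
     since [X i w < 0]. *)
  have := g_ge0 i (uJ _ Jp); rewrite le_eqVlt => /predU1P[<-|]; last exact: XJ.
  by rewrite mul0r ltW.
have /le_inf0P[//|_] := XJ i; apply; by exists p.
Qed.

(** * Measurability and univariate margins *)

Lemma max_linear_process : is_process unit_itv eta.
Proof.
move=> t ut; apply: (measurability _ (RGenOInfty.measurableE R)).
move=> _ [_ [x ->] <-]; rewrite setTI.
rewrite (_ : _ @^-1` _ = ~` below [set (t, x)]).
  by apply: measurableC; apply: measurable_below => _ ->.
apply/seteqP; split=> w; rewrite /below/= in_itv/= andbT.
  by move=> xe /(_ (t, x) erefl)/=; rewrite leNgt xe.
by move=> h; rewrite ltNge; apply/negP => ex; apply: h => _ ->.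
Qed.

Lemma max_linear_margins : neg_exp_margins unit_itv P eta.
Proof.
move=> t x ut x0.
have -> : [set w | eta t w <= x] = below [set (t, x)].
  by apply/seteqP; split=> w /=; [move=> ? _ -> //|move=> /(_ (t, x) erefl)].
have lb1 i : has_lbound [set g i p.1 * p.2 | p in [set (t, x)]].
  by exists (g i t * x) => _ [_ -> <-].
rewrite prob_below//; last by move=> _ ->.
(* As [x <= 0 <= g i t], the adjoined 0 does not lower the infimum. The two signs bring out the
   nonnegative factor [- x] for homogeneity. *)
have -> : level [set (t, x)] = (fun i => - (- x * g i t)).
  apply/funext => i; rewrite /level mulNr opprK mulrC.
  apply/eqP; rewrite eq_le; apply/andP; split.
    have /le_inf0P[//|_] :=
      lexx (inf (0 |` [set g i p.1 * p.2 | p in [set (t, x)]])).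
    by apply; exists (t, x).
  apply/le_inf0P => //; split=> [|_ [_ -> <-]//].
  by rewrite mulr_ge0_le0// g_ge0.
by rewrite DnormN DnormZ ?oppr_ge0// g_norm1// mule1 -EFinN opprK.
Qed.

(** * Continuity of the paths *)

(** Passing to reciprocals moves the division from [g i t], which may vanish, to [X i w], which does
    not. Both inequalities come from [max_linear_leP], tested at [- M^-1] and at [eta t w]
    itself. *)
Let max_linearE t w : unit_itv t -> (forall i, X i w < 0) ->
  let M := fmax (fun i => g i t / - X i w) in 0 < M /\ eta t w = - M^-1.
Proof.
move=> ut Xw M; have [j gj] := g_neq0 ut.
have X0 i : 0 < - X i w by rewrite oppr_gt0.
have M0 : 0 < M.
  apply: lt_le_trans (le_fmax _ j).
  by rewrite divr_gt0// lt0r gj g_ge0.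
have etaM : eta t w <= - M^-1.
  apply/max_linear_leP => [i||i gi]; [exact: g_ge0|by exists j|].
  rewrite mulrN lerNr ler_pdivrMr// -ler_pdivrMl// mulrC.
  exact: (le_fmax (fun i => g i t / - X i w)).
have eta0 : 0 < - eta t w.
  by rewrite oppr_gt0 (le_lt_trans etaM)// oppr_lt0 invr_gt0.
split=> //; apply/eqP; rewrite eq_le etaM/= lerNl.
rewrite -[leLHS]invrK lef_pV2 ?posrE ?invr_gt0//.
apply/fmax_leP => i; have := g_ge0 i ut.
rewrite le_eqVlt => /predU1P[<-|gi]; first by rewrite mul0r invr_ge0 ltW.
rewrite ler_pdivrMr// mulrC ler_pdivlMr// mulrN lerN2.
have /max_linear_leP h := lexx (eta t w).
by apply: h => // [k|]; [exact: g_ge0|exists j].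
Qed.

Lemma max_linear_paths : {ae P, forall w, Cminus (path_of eta w)}.
Proof.
apply: (filterS _ X_all_lt0) => w Xw; split=> [|t ut]; last first.
  rewrite /path_of; have [M0 ->] := max_linearE ut Xw.
  by rewrite oppr_le0 invr_ge0 ltW.
apply/subspace_continuousP => t ut; rewrite /path_of /from_subspace.
have [M0 ->] := max_linearE ut Xw.
pose M s := fmax (fun i => g i s / - X i w).
have cM : {within unit_itv, continuous M}.
  apply: continuous_fmax => i s; apply: cvgMl; case: (g_Cplus i) => cg _.
  exact: cg.
move/subspace_continuousP : cM => /(_ t ut) cM.
have {}cM : - (M s)^-1 @[s --> within unit_itv (nbhs t)] --> - (M t)^-1.
  by apply: cvgN; apply: cvgV => //; rewrite gt_eqF.
(* The closed formula is available only on the unit interval, which suffices for a limit within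
   it. *)
apply: cvg_trans cM; apply: near_eq_cvg; near=> s.
have us : unit_itv s by near: s; exact: withinT.
by have [_ ->] := max_linearE us Xw.
Unshelve. all: by end_near. Qed.

(** * The generator process and its D-norm *)

Lemma max_generator_is_generator :
  is_generator_process Q (max_generator g Z).
Proof.
have [c c1 Zc] := generator_bounded Z_gen; have [M M0 gM] := g_bounded.
split.
- by move=> t ut; exact: (measurable_weighted_fmax Z_gen).
- apply: (filterS _ Zc) => w {}Zc; split=> [|t ut]; last first.
    by apply: fmax_ge0 => i; rewrite mulr_ge0 ?g_ge0//; case/andP: (Zc i).
  apply: continuous_fmax => i s; apply: cvgMl; case: (g_Cplus i) => cg _.
  exact: cg.
(* The maximum with 1 meets the requirement that the bound be at least 1. *)
- exists (Num.max 1 (M * c)); first by rewrite le_max lexx.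
  move=> t ut; apply: (filterS _ Zc) => w {}Zc.
  apply/fmax_leP => i; rewrite le_max; apply/orP; right.
  by case/andP: (Zc i) => Z0 Zic; rewrite ler_pM ?g_ge0 ?gM.
(* Since [g i t >= 0], the mean at [t] is by definition the D-norm of the vector of the [g i t],
   which is 1. *)
- move=> t ut; rewrite -(g_norm1 ut) /Dnorm; congr expectation.
  apply/funext => w; congr fmax; apply/funext => i.
  by rewrite ger0_norm// g_ge0.
Qed.

Definition graph_on (f : R -> R) : set (R * R) :=
  [set (t, f t) | t in unit_itv].

Let unit_graph f p : graph_on f p -> unit_itv p.1.
Proof. by case=> t ut <-. Qed.

Let level_graph (f : R -> R) i :
  level (graph_on f) i = inf (0 |` [set g i t * f t | t in unit_itv]).
Proof.
congr (inf (0 |` _)); apply/seteqP; split=> y.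
  by move=> [_ [t ut <-] <-]; exists t.
by move=> [t ut <-]; exists (t, f t) => //; exists t.
Qed.

Let has_lbound_graph (f : R -> R) i :
  (exists M, forall t, unit_itv t -> `|f t| <= M) ->
  has_lbound [set g i t * f t | t in unit_itv].
Proof.
have [M M0 gM] := g_bounded.
move=> [K fK]; exists (- (M * K)) => _ [t ut <-].
rewrite lerNl -mulrN (le_trans (ler_norm _))// normrM normrN.
by rewrite ler_pM// ?fK// ger0_norm ?gM ?g_ge0.
Qed.

Let measurable_sup_path (f : R -> R) :
  measurable_fun setT (fun w : T' =>
    ereal_sup [set (`|f t| * max_generator g Z t w)%:E | t in unit_itv]).
Proof.
apply: (measurability _ (ErealGenOInfty.measurableE R)).
move=> _ [_ [x ->] <-]; rewrite setTI.
(* The supremum over an uncountable family is measurable because its sublevel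
   sets are finite intersections of preimages of closed sets. *)
pose F i := [set z | forall t, unit_itv t -> `|f t| * g i t * z <= x].
rewrite (_ : _ @^-1` _ = ~` \bigcap_(i in [set: 'I_d.+1]) (Z i @^-1` F i)).
  apply: measurableC; apply: fin_bigcap_measurable => // i _.
  rewrite -[_ @^-1` _]setTI; apply: (generator_measurable Z_gen) => //.
  apply: closed_measurable.
  rewrite (_ : F i = \bigcap_(t in unit_itv)
    ((fun z => `|f t| * g i t * z) @^-1` [set y | y <= x])).
    apply: closed_bigI => t _; apply: closed_comp => [z _|].
      exact: mulrl_continuous.
    exact: closed_le.
  by apply/seteqP; split.
have supP w : (ereal_sup [set (`|f t| * max_generator g Z t w)%:E |
      t in unit_itv] <= x%:E)%E <->
    (\bigcap_(i in [set: 'I_d.+1]) (Z i @^-1` F i)) w.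
  split=> [sx i _ t ut|Fw].
    apply: (@le_trans _ _ (`|f t| * max_generator g Z t w)).
      by rewrite -mulrA ler_wpM2l//; exact: (le_fmax (fun i => g i t * Z i w)).
    rewrite -lee_fin; apply: le_trans sx.
    by apply: ereal_sup_ubound; exists t.
  apply: ge_ereal_sup => _ [t ut <-]; rewrite lee_fin -fmaxZl//.
  by apply/fmax_leP => i; rewrite mulrA; exact: Fw.
apply/seteqP; split=> w /=; rewrite in_itv/= andbT.
  by move=> xs /supP; rewrite leNgt xs.
by move=> h; rewrite ltNge; apply/negP => /supP.
Qed.

(** Where all [Z i w >= 0], the supremum over [t] commutes with the maximum over [i] and with the
    factor [Z i w]; the supremum of [|f t| * g i t] over [t] is minus the level. Hence the two
    integrands agree almost surely. *)
Lemma Dnorm_process_max_generator (f : R -> R) :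
  (exists M, forall t, unit_itv t -> `|f t| <= M) ->
  (forall t, unit_itv t -> f t <= 0) ->
  Dnorm_process Q (max_generator g Z) f = Dnorm Q Z (level (graph_on f)).
Proof.
move=> f_bnd f0; rewrite DnormE; apply: ae_eq_integral => //.
  by apply/measurable_EFinP; exact: (measurable_weighted_fmax Z_gen).
have [c _ Zc] := generator_bounded Z_gen.
apply: (filterS _ Zc) => w {}Zc _; have Z0 i : 0 <= Z i w by case/andP: (Zc i).
have lb i := has_lbound_graph i f_bnd.
have lvl0 i : level (graph_on f) i <= 0.
  rewrite level_graph.
  by have /le_inf0P[] := lexx (inf (0 |` [set g i t * f t | t in unit_itv])).
have lvlf i t : unit_itv t -> level (graph_on f) i <= g i t * f t.
  move=> ut; rewrite level_graph.
  have /le_inf0P[//|_] := lexx (inf (0 |` [set g i t * f t | t in unit_itv])).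
  by apply; exists t.
have Zt0 t : unit_itv t -> 0 <= max_generator g Z t w.
  by move=> ut; apply: fmax_ge0 => i; rewrite mulr_ge0 ?g_ge0.
apply/eqP; rewrite eq_le; apply/andP; split.
  apply: ge_ereal_sup => _ [t ut <-]; rewrite lee_fin -fmaxZl//.
  apply/fmax_leP => i; apply: le_trans (le_fmax _ i).
  rewrite mulrA ler_wpM2r// !ler0_norm ?f0//.
  by rewrite mulNr lerN2 mulrC lvlf.
set S := ereal_sup _.
have leS t : unit_itv t -> ((`|f t| * max_generator g Z t w)%:E <= S)%E.
  by move=> ut; apply: ereal_sup_ubound; exists t.
have u0 : unit_itv (0 : R) by rewrite /unit_itv/= in_itv/= lexx ler01.
(* For +oo there is nothing to prove; -oo is excluded by the real value at time 0. *)
case: S leS => [r| |] leS; last 2 first.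
- by rewrite leey.
- by have := leS _ u0; rewrite leNgt ltNyr.
have r0 : 0 <= r.
  by rewrite -lee_fin (le_trans _ (leS _ u0))// lee_fin mulr_ge0 ?Zt0.
rewrite lee_fin; apply/fmax_leP => i; have := Z0 i.
rewrite le_eqVlt => /predU1P[<-|Zi0]; first by rewrite mulr0.
(* Dividing by [Z i w > 0] reduces the claim to [- (r / Z i w)] being a lower bound of the set
   defining the level; [r0] settles the adjoined 0. *)
rewrite -ler_pdivlMr// ler0_norm// lerNl level_graph.
apply/le_inf0P => //; split=> [|_ [t ut <-]].
  by rewrite oppr_le0 divr_ge0 ?Z0.
rewrite lerNl ler_pdivlMr// -lee_fin; apply: le_trans (leS t ut).
rewrite lee_fin ler0_norm ?f0// !mulNr (mulrC (g i t)) -mulrA -!mulNr.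
by rewrite ler_wpM2l ?oppr_ge0 ?f0//; exact: (le_fmax (fun i => g i t * Z i w)).
Qed.

Lemma max_linear_has_generator :
  has_generator_process P eta Q (max_generator g Z).
Proof.
split; first exact: max_generator_is_generator.
move=> f [[f_bnd _] f0] /=.
have -> : [set w | forall t, unit_itv t -> eta t w <= f t] = below (graph_on f).
  apply/seteqP; split=> w /=; first by move=> h _ [t ut <-]; exact: h.
  by move=> h t ut; apply: (h (t, f t)); exists t.
split; first by apply: measurable_below => p; exact: unit_graph.
rewrite Dnorm_process_max_generator// prob_below//.
  by move=> p; exact: unit_graph.
move=> i; have [m mg] := has_lbound_graph i f_bnd.
by exists m => _ [_ [t ut <-] <-]; apply: mg; exists t.
Qed.

(** * Max-stability *)

Lemma max_linear_max_stable : max_stable unit_itv (@C01 R) P eta.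
Proof.
(* There are [n.+1] copies, whence the norming constant; the location is 0. *)
move=> n; pose a : R := n.+1%:R^-1.
have a0 : 0 < a by rewrite invr_gt0.
exists (fun=> a), (fun=> 0); split;
  [by move=> ?; exact: cvg_cst|by move=> ?; exact: cvg_cst|by []|].
move=> d1 T1 P1 xi [mxi law_xi indep].
have mfx : is_process unit_itv (fun t w => fmax (fun k => (xi k t w - 0) / a)).
  move=> t ut; apply: measurable_fmax => k; under eq_fun do rewrite subr0.
  by apply: measurable_funM => //; exact: mxi.
apply: eq_law_orthant => [//||J fJ uJ]; first exact: max_linear_process.
pose aJ : set (R * R) := [set (p.1, a * p.2) | p in J].
have faJ : finite_set aJ by exact: finite_image.
have uaJ p : aJ p -> unit_itv p.1 by case=> q Jq <-; exact: (uJ q Jq).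
(* The normalized maximum obeys a bound [y] iff every copy obeys [a * y]; independence then turns
   the intersection into a power. *)
have -> : path_of (fun t w => fmax (fun k => (xi k t w - 0) / a)) @^-1`
      orthant J =
    \bigcap_(k in [set: 'I_n.+1]) (path_of (xi k) @^-1` orthant aJ).
  apply/seteqP; split=> w.
    move=> Jw k _ _ [p Jp <-]; have /fmax_leP/(_ k) := Jw p Jp.
    by rewrite subr0 ler_pdivrMr// mulrC.
  move=> Jw p Jp; apply/fmax_leP => k; rewrite subr0 ler_pdivrMr// mulrC.
  by apply: (Jw k I (p.1, a * p.2)); exists p.
have ev := path_event_orthant faJ uaJ.
rewrite (indep (fun=> orthant aJ))//.
under eq_bigr do rewrite law_xi//.
have lbJ i : has_lbound [set g i p.1 * p.2 | p in J].
  by apply: finite_has_lbound; exact: finite_image.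
have lbaJ i : has_lbound [set g i p.1 * p.2 | p in aJ].
  by apply: finite_has_lbound; exact: finite_image.
(* The preimage of an orthant under the paths of [eta] unfolds to [below]. *)
rewrite (prob_below uaJ lbaJ : P (path_of eta @^-1` orthant aJ) = _).
rewrite (prob_below uJ lbJ : P (path_of eta @^-1` orthant J) = _).
have -> : level aJ = (fun i => a * level J i).
  apply/funext => i; rewrite /level -inf0M//; congr (inf (0 |` _)).
  apply/seteqP; split=> y.
    move=> [_ [p Jp <-] <-].
    by exists (g i p.1 * p.2); [exists p|rewrite mulrCA].
  by move=> [_ [p Jp <-] <-]; exists (p.1, a * p.2); [exists p|rewrite mulrCA].
(* The D-norm is a real [r], and the power [n.+1] of [expR (- (a * r))] is [expR (- r)] because
   [n.+1%:R * a = 1]. *)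
rewrite DnormZ ?(ltW a0)//; have := Dnorm_fin_num Z_gen (level J).
case: (Dnorm Q Z (level J)) => // r _.
rewrite -EFinM -!EFinN /= prodEFin prodr_const card_ord -expRM_natl.
by rewrite mulrN mulrA mulfV// mul1r.
Qed.

Lemma max_linear_smsp : smsp P eta.
Proof.
split; [exact: max_linear_process|exact: max_linear_max_stable|
  exact: max_linear_paths|exact: max_linear_margins].
Qed.

End max_linear_process.

(** * Conclusion for a standard max-stable vector *)

Unset Implicit Arguments.

Theorem lemma2p1 (R : realType)
    (dT : measure_display) (T : measurableType dT) (P : probability T R)
    (dT' : measure_display) (T' : measurableType dT') (Q : probability T' R)
    (d : nat) (X : 'I_d.+1 -> T -> R) (Z : 'I_d.+1 -> T' -> R)
    (g : 'I_d.+1 -> R -> R)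
    (X_sms : standard_max_stable_vector P X)
    (X_lt0 : forall i, {ae P, forall w, X i w < 0})
    (X_gen : has_generator P X Q Z)
    (g_Cplus : forall i, Cplus (g i))
    (g_norm1 : forall t, unit_itv t -> Dnorm Q Z (fun i => g i t) = 1%E) :
  smsp P (max_linear X g) /\
  has_generator_process P (max_linear X g) Q (max_generator g Z).
Proof.
case: X_sms => X_meas _ _; split.
  exact: max_linear_smsp X_meas X_lt0 X_gen g_Cplus g_norm1.
exact: max_linear_has_generator X_meas X_lt0 X_gen g_Cplus g_norm1.
Qed.
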